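(* Let $\Lambda,\Gamma$ be rings, $C$ a $\Lambda$-$\Gamma$-bimodule, and $M$ a $\Gamma$-module with a fixed resolution $\cdots\to P_1\xrightarrow{d_1}P_0\to M\to0$ by finitely generated projective $\Gamma$-modules. Let $W$ be a $\Lambda$-module and $\lambda_W\colon W\to M^{\dagger}=\operatorname{Hom}_\Gamma(M,C)$ a homomorphism of $\Lambda$-modules. Let $S$ be a nonempty set and, for each $p\in S$, let $d_p$ be a function assigning to every $\Lambda$-module an element of $\{0,1,2,\dots\}\cup\{\infty\}$, such that $d_p$ satisfies conditions (d1), (d2), (d3) for every $p\in S$. Write $t=t(\lambda_W)$ and assume $t<\infty$. Then: (A) $A_{0}(\mathrm{E}^{t+1}(\lambda_{W}))\cap X_{t+1}(C)= A_{t}(W)\cap Y^{C}(W)$. Furthermore, if $t\ge 2$, then for $0\le i\le 2$ $$A_{0}(\mathrm{E}^{t+1}(\lambda_{W}))\cap X_{t+i-1}(C)=A_{t+i-2}(O^{i}(\lambda_{W}))\cap Y^{C}(O^{i}(\lambda_{W})).$$ (B) $A_{0}(\mathrm{E}^{t+1}(\lambda_{W}))\cap X_{t+1}(C)\neq\emptyset$ if and only if $t=\widetilde{S}^{C}(W)$. Furthermore, if $t\ge2$, then for $0\le i\le 2$: $A_{0}(\mathrm{E}^{t+1}(\lambda_{W}))\cap X_{t+i-1}(C)\neq\emptyset$ if and only if $t+i-2=\widetilde{S}^{C}(O^{i}(\lambda_{W}))$.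
   Context: Conventions: $\Lambda$-modules are left modules, $\Gamma$-modules are right modules, so $(-)^\dagger=\operatorname{Hom}_\Gamma(-,C)$ takes $\Gamma$-modules to $\Lambda$-modules. Infimum of the empty set is $\infty$. Conditions on a function $d$ from $\Lambda$-modules to $\{0,1,\dots\}\cup\{\infty\}$, required for every short exact sequence $0\to K\to L\to N\to0$ of $\Lambda$-modules: (d1) if $d(L)>d(K)$, then $d(K)=d(N)+1$; (d2) if $d(L)>d(N)$, then $d(K)=d(N)+1$; (d3) if $d(L)<d(N)$, then $d(K)\le d(L)$. Definition of $\mathrm{E}^i$ and $t$: $\mathrm{E}^1(\lambda_W)=\operatorname{Ker}\lambda_W$, $\mathrm{E}^2(\lambda_W)=\operatorname{Coker}\lambda_W$, $\mathrm{E}^i(\lambda_W)=\operatorname{Ext}^{i-2}_\Gamma(M,C)$ for $i\ge3$; and $t(\lambda_W)=\inf\{i\ge0\mid \mathrm{E}^{i+1}(\lambda_W)\ne0\}$. Definition of $O^i$: $O^0(\lambda_W)=\operatorname{Coker}(d_1^\dagger\colon P_0^\dagger\to P_1^\dagger)$, $O^1(\lambda_W)=\operatorname{Im}(d_1^\dagger\colon P_0^\dagger\to P_1^\dagger)$, $O^2(\lambda_W)=W$. For a $\Lambda$-module $N$ and an integer $i$: $A_i(N)=\{p\in S\mid d_p(N)=i\}$; $X_i(N)=\{p\in S\mid i\le d_p(N)\}$; $Y^C(N)=\{p\in S\mid d_p(N)<d_p(C)\}$; $\widetilde{S}^C(N)$ is the supremum of the integers $i$ such that $d_p(N)\ge\inf\{i,d_p(C)\}$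 for all $p\in S$. *)

(* Defs.v *)
From HB Require Import structures.
From mathcomp Require Import all_boot all_order all_algebra ring_quotient.
From mathcomp Require Import boolp classical_sets functions constructive_ereal.
Set Implicit Arguments.
Unset Strict Implicit.
Unset Printing Implicit Defensive.
Import Order.TTheory GRing.Theory Num.Theory.
Local Open Scope classical_set_scope.
Local Open Scope ring_scope.
Local Open Scope quotient_scope.

(* Rings are arbitrary unital rings (pzRingType allows the zero ring). Left
   modules over Lambda are [lmodType Lambda]; right modules over Gamma are left
   modules over the converse ring, [lmodType Gamma^c], x * a being written
   (a : Gamma^c) *: x. *)

Definition short_exact (R : pzRingType) (K L N : lmodType R)
    (f : {linear K -> L}) (g : {linear L -> N}) : Prop :=
  [/\ injective f, range f = g @^-1` [set 0] & range g = setT].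

Definition finitely_generated (R : pzRingType) (P : lmodType R) : Prop :=
  exists n (v : 'I_n -> P), forall x : P,
    exists c : 'I_n -> R, x = \sum_(i < n) c i *: v i.

Definition projective (R : pzRingType) (P : lmodType R) : Prop :=
  forall (A B : lmodType R) (g : {linear A -> B}) (f : {linear P -> B}),
    range g = setT -> exists h : {linear P -> A}, forall x, g (h x) = f x.

Section Submodule.
Variables (R : pzRingType) (V : lmodType R) (A : submodClosed V).

Record submodule := Submodule { submodule_val : V; _ : submodule_val \in A }.

HB.instance Definition _ := [isSub for submodule_val].
HB.instance Definition _ := [Choice of submodule by <:].
HB.instance Definition _ := [SubChoice_isSubLmodule of submodule by <:].

End Submodule.

Section QuotientModule.
Variables (R : pzRingType) (V : lmodType R) (A : submodClosed V).

(* A itself; a submodClosed need not be recognised as closed under opposite. *)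
Definition quot_pred : {pred V} := A.

HB.instance Definition _ :=
  GRing.isSubmodClosed.Build R V quot_pred (submodClosedP A).

(* The quotient V / A, with the Z-module structure of [Quotient.quot]. *)
Definition quotmod : Type := Quotient.quot quot_pred.

HB.instance Definition _ := GRing.Zmodule.on quotmod.

Definition quotmod_pi (x : V) : quotmod := \pi_(Quotient.quot quot_pred) x.

Lemma quotmod_piP (x y : V) : quotmod_pi x = quotmod_pi y <-> x - y \in A.
Proof.
rewrite (Quotient.idealrBE quot_pred); split=> [H|/eqP //].
by apply/eqP; exact: H.
Qed.

Lemma quotmod_pi_surj (u : quotmod) : exists x, u = quotmod_pi x.
Proof. by exists (repr (u : Quotient.quot quot_pred)); rewrite /quotmod_pi reprK. Qed.

Lemma quotmod_piD (x y : V) :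
  quotmod_pi (x + y) = quotmod_pi x + quotmod_pi y.
Proof. exact: Quotient.pi_add. Qed.

Definition quotmod_scale (a : R) (u : quotmod) : quotmod :=
  quotmod_pi (a *: repr (u : Quotient.quot quot_pred)).

Lemma quotmod_piZ a (x : V) :
  quotmod_scale a (quotmod_pi x) = quotmod_pi (a *: x).
Proof.
apply/quotmod_piP; rewrite -scalerBr rpredZ//; apply/quotmod_piP.
by rewrite /quotmod_pi reprK.
Qed.

Let scaleA a b u :
  quotmod_scale a (quotmod_scale b u) = quotmod_scale (a * b) u.
Proof.
by have [x ->] := quotmod_pi_surj u; rewrite !quotmod_piZ scalerA.
Qed.

Let scale1 : left_id 1 quotmod_scale.
Proof.
by move=> u; have [x ->] := quotmod_pi_surj u; rewrite quotmod_piZ scale1r.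
Qed.

Let scaleDr : right_distributive quotmod_scale +%R.
Proof.
move=> a u v; have [x ->] := quotmod_pi_surj u.
have [y ->] := quotmod_pi_surj v.
by rewrite -quotmod_piD !quotmod_piZ scalerDr quotmod_piD.
Qed.

Let scaleDl u : {morph quotmod_scale^~ u : a b / a + b}.
Proof.
move=> a b; have [x ->] := quotmod_pi_surj u.
by rewrite !quotmod_piZ scalerDl quotmod_piD.
Qed.

HB.instance Definition _ :=
  GRing.Zmodule_isLmodule.Build R quotmod scaleA scale1 scaleDr scaleDl.

Lemma quotmod_pi_linear : linear quotmod_pi.
Proof. by move=> a x y; rewrite quotmod_piD -quotmod_piZ. Qed.

HB.instance Definition _ :=
  GRing.isLinear.Build R V quotmod *:%R quotmod_pi quotmod_pi_linear.

End QuotientModule.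

Section KernelCokernel.
Variables (R : pzRingType) (U V : lmodType R) (f : {linear U -> V}).

Definition ker_pred : {pred U} := fun x => f x == 0.

Lemma ker_pred_submod : submod_closed ker_pred.
Proof.
split=> [|a x y]; rewrite !unfold_in ?linear0// => /eqP fx /eqP fy.
by rewrite linearP fx fy scaler0 addr0.
Qed.

HB.instance Definition _ :=
  GRing.isSubmodClosed.Build R U ker_pred ker_pred_submod.

Definition im_pred : {pred V} := fun y => `[< range f y >].

Lemma im_pred_submod : submod_closed im_pred.
Proof.
split=> [|a x y]; rewrite !unfold_in.
  by apply/asboolP; exists 0; rewrite ?linear0.
move=> /asboolP[u _ <-] /asboolP[v _ <-]; apply/asboolP.
by exists (a *: u + v); rewrite ?linearP.
Qed.

HB.instance Definition _ :=
  GRing.isSubmodClosed.Build R V im_pred im_pred_submod.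

Definition Ker : lmodType R := submodule ker_pred.
Definition Im : lmodType R := submodule im_pred.
Definition Coker : lmodType R := quotmod im_pred.

End KernelCokernel.

Section Homology.
Variables (R : pzRingType) (U V W : lmodType R).
Variables (f : {linear U -> V}) (g : {linear V -> W}).

(* The image of f, as a submodule of the kernel of g; no proof that g \o f = 0
   is needed to form the quotient. *)
Definition boundary_pred : {pred Ker g} := fun x => \val x \in im_pred f.

Lemma boundary_pred_submod : submod_closed boundary_pred.
Proof.
have inE x : (x \in boundary_pred) = (\val x \in im_pred f) by [].
split=> [|a x y]; rewrite !inE ?raddf0 ?rpred0// linearP => fx fy.
by rewrite rpredD// rpredZ.
Qed.

HB.instance Definition _ :=
  GRing.isSubmodClosed.Build R (Ker g) boundary_pred boundary_pred_submod.

Definition homology : lmodType R := quotmod boundary_pred.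

End Homology.

HB.mixin Record Lmodule_isBimodule (Lambda Gamma : pzRingType) C
    of GRing.Lmodule Lambda C := {
  rscale : C -> Gamma -> C;
  rscaleA : forall x a b, rscale (rscale x a) b = rscale x (a * b);
  rscale1 : forall x, rscale x 1 = x;
  rscaleDl : forall a, {morph rscale^~ a : x y / x + y};
  rscaleDr : forall x, {morph rscale x : a b / a + b};
  scaler_rscale : forall (l : Lambda) x a,
    l *: rscale x a = rscale (l *: x) a
}.

#[short(type="bimodType")]
HB.structure Definition Bimodule (Lambda Gamma : pzRingType) :=
  {C of GRing.Lmodule Lambda C & Lmodule_isBimodule Lambda Gamma C}.

Section RightModule.
Variables (Lambda Gamma : pzRingType) (C : bimodType Lambda Gamma).

(* C as a right Gamma-module. *)
Definition right_module : Type := C.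

HB.instance Definition _ := GRing.Zmodule.on right_module.

Definition right_module_scale (a : Gamma^c) (x : right_module) :
  right_module := rscale (x : C) a.

Let scaleA a b u :
  right_module_scale a (right_module_scale b u) = right_module_scale (a * b) u.
Proof. exact: rscaleA. Qed.

Let scale1 : left_id 1 right_module_scale.
Proof. exact: rscale1. Qed.

Let scaleDr : right_distributive right_module_scale +%R.
Proof. by move=> a; exact: rscaleDl. Qed.

Let scaleDl u : {morph right_module_scale^~ u : a b / a + b}.
Proof. by move=> a b; exact: (rscaleDr (u : C)). Qed.

HB.instance Definition _ := GRing.Zmodule_isLmodule.Build Gamma^c right_module
  scaleA scale1 scaleDr scaleDl.

End RightModule.

Section Dual.
Variables (Lambda Gamma : pzRingType) (C : bimodType Lambda Gamma).

Section DualModule.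
Variable X : lmodType Gamma^c.

(* Functions X -> C form a left Lambda-module pointwise; the Gamma-linear ones
   are a submodule of it. *)
Definition dual_pred : {pred X -> C} :=
  fun f => `[< linear (f : X -> right_module C) >].

Lemma dual_pred_submod : submod_closed dual_pred.
Proof.
split=> [|l f g]; rewrite !unfold_in.
  by apply/asboolP => a x y; rewrite /= scaler0 addr0.
move=> /asboolP flin /asboolP glin; apply/asboolP => a x y.
have fE : f (a *: x + y) = rscale (f x) a + f y by exact: flin.
have gE : g (a *: x + y) = rscale (g x) a + g y by exact: glin.
change (l *: f (a *: x + y) + g (a *: x + y)
  = rscale (l *: f x + g x) a + (l *: f y + g y)).
by rewrite fE gE rscaleDl -scaler_rscale scalerDr addrACA.
Qed.

HB.instance Definition _ :=
  GRing.isSubmodClosed.Build Lambda (X -> C) dual_pred dual_pred_submod.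

Definition dual : lmodType Lambda := submodule dual_pred.

End DualModule.

Section DualMap.
Variables (X Y : lmodType Gamma^c) (f : {linear X -> Y}).

Lemma dual_map_subproof (g : dual Y) : \val g \o f \in @dual_pred X.
Proof.
have /asboolP glin := valP g.
by apply/asboolP => a x y; rewrite /= linearP; exact: glin.
Qed.

Definition dual_map (g : dual Y) : dual X := Submodule (dual_map_subproof g).

Lemma dual_map_linear : linear dual_map.
Proof. by move=> l g h; apply: val_inj; apply/funext. Qed.

HB.instance Definition _ :=
  GRing.isLinear.Build Lambda (dual Y) (dual X) *:%R dual_map dual_map_linear.

End DualMap.
End Dual.

Arguments dual_map {Lambda Gamma} C {X Y} f g.

(* A resolution ... -> P 1 -> P 0 -> M -> 0 by finitely generated projective
   modules; res_diff n is the differential d_{n+1} : P_{n+1} -> P_n. *)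
Record fgproj_resolution (R : pzRingType) (M : lmodType R) := FgProjResolution {
  res_obj :> nat -> lmodType R;
  res_diff : forall n, {linear res_obj n.+1 -> res_obj n};
  res_aug : {linear res_obj 0%N -> M};
  res_fg : forall n, finitely_generated (res_obj n);
  res_proj : forall n, projective (res_obj n);
  res_aug_surj : range res_aug = setT;
  res_exact0 : range (res_diff 0) = res_aug @^-1` [set 0];
  res_exact : forall n, range (res_diff n.+1) = res_diff n @^-1` [set 0]
}.

Section Invariants.
Variables (Lambda Gamma : pzRingType) (C : bimodType Lambda Gamma).
Variables (M : lmodType Gamma^c) (P : fgproj_resolution M).

Definition codiff n : {linear dual C (P n) -> dual C (P n.+1)} :=
  dual_map C (res_diff P n).

(* Ext^n_Gamma(M, C), computed as a Lambda-module from the resolution P. *)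
Definition Ext (n : nat) : lmodType Lambda :=
  match n with
  | 0%N => Ker (codiff 0%N)
  | m.+1 => homology (codiff m) (codiff m.+1)
  end.

Variables (W : lmodType Lambda) (lambda : {linear W -> dual C M}).

(* E^i is only meaningful for i >= 1; the value at 0 is arbitrary. *)
Definition E_ (i : nat) : lmodType Lambda :=
  match i with
  | 0%N | 1%N => Ker lambda
  | 2%N => Coker lambda
  | _ => Ext (i - 2)
  end.

Definition t_ : \bar int :=
  infimum +oo%E [set (i%:Z)%:E | i in [set i : nat | exists x : E_ i.+1, x <> 0]].

(* O^i is only meaningful for i <= 2. *)
Definition O_ (lambda : {linear W -> dual C M}) (i : nat) : lmodType Lambda :=
  match i with
  | 0%N => Coker (codiff 0%N)
  | 1%N => Im (codiff 0%N)
  | _ => W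
  end.

End Invariants.

Arguments E_ {Lambda Gamma C M} P {W} lambda i.
Arguments t_ {Lambda Gamma C M} P {W} lambda.
Arguments O_ {Lambda Gamma C M} P {W} lambda i.

Section Conditions.
Variables (Lambda : pzRingType) (d : lmodType Lambda -> \bar int).
Local Open Scope ereal_scope.

(* The values of d are in {0, 1, 2, ...} with +oo adjoined. *)
Definition nneg_valued : Prop := forall N, 0 <= d N.

Definition cond_d1 : Prop :=
  forall (K L N : lmodType Lambda) (f : {linear K -> L}) (g : {linear L -> N}),
    short_exact f g -> d L > d K -> d K = d N + 1.

Definition cond_d2 : Prop :=
  forall (K L N : lmodType Lambda) (f : {linear K -> L}) (g : {linear L -> N}),
    short_exact f g -> d L > d N -> d K = d N + 1.

Definition cond_d3 : Prop :=
  forall (K L N : lmodType Lambda) (f : {linear K -> L}) (g : {linear L -> N}),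
    short_exact f g -> d L < d N -> d K <= d L.

End Conditions.

Section Loci.
Variables (Lambda : pzRingType) (S : Type) (d : S -> lmodType Lambda -> \bar int).
Local Open Scope ereal_scope.

Definition A_ (i : int) (N : lmodType Lambda) : set S :=
  [set p | d p N = i%:E].

Definition X_ (i : int) (N : lmodType Lambda) : set S :=
  [set p | i%:E <= d p N].

Definition Y_ (C N : lmodType Lambda) : set S := [set p | d p N < d p C].

Definition Stilde (C N : lmodType Lambda) : \bar int :=
  supremum -oo [set i%:E | i in
    [set i : int | forall p, Order.min i%:E (d p C) <= d p N]].

End Loci.

(* Main.v *)
(* Each d_p behaves like a depth: (d1)-(d3) give the depth lemma, and direct
   summands have at least the depth of the ambient module, so every P_n^dagger,
   a retract of some C^m, has depth at least c = d_p(C). Write E = E^(t+1).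
   Call N detected by E at level k if min(k, c) <= d(N), and
   d(E) = 0 <-> d(N) = k as soon as k < c; both parts of the theorem follow
   formally from this property.
   It climbs by one level along 0 -> K -> L -> N -> 0 when L has depth at least
   min(k + 2, c). For t = 0 use 0 -> E -> W -> Im lambda -> 0; for t = 1 use
   0 -> W -> M^dagger -> E -> 0. For t >= 2 the modules E^i with i <= t vanish,
   and with B^j the image of P_(j-1)^dagger -> P_j^dagger one climbs from
   E = Ext^(t-1) to B^(t-1) through the cocycles, then down to B^1 = O^1 and to
   W = M^dagger. The module O^0 = P_1^dagger / B^1 is B^2 if t > 2, and is an
   extension of B^2 by E if t = 2. *)
From HB Require Import structures.
Require Import Defs.
From mathcomp Require Import all_boot all_order all_algebra zify.
From mathcomp Require Import boolp classical_sets functions constructive_ereal.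
Import Order.TTheory.
Import GRing.Theory.
Local Open Scope classical_set_scope.
Local Open Scope ring_scope.

(** * Exact sequences of modules *)

(** The maps are forgotten because (d1)-(d3) compare only the three modules. *)
Definition ses {R : pzRingType} (K L N : lmodType R) : Prop :=
  exists (f : {linear K -> L}) (g : {linear L -> N}), short_exact f g.

Section ExactSequences.
Context {R : pzRingType}.
Implicit Types U V W K L N X Y : lmodType R.

(** Bundles functions built inside a proof, for example by choice or on representatives. *)
Lemma linear_pack U V (f : U -> V) :
  linear f -> exists h : {linear U -> V}, h =1 f.
Proof.
move=> f_lin; pose m := GRing.isLinear.Build R U V *:%R f f_lin.
pose h : {linear U -> V} := HB.pack f m.
by exists h.
Qed.

Lemma range0P {U V W} (f : {linear U -> V})
    (g : {linear V -> W}) :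
  range f = g @^-1` [set 0] ->
  (forall x, g (f x) = 0) /\ (forall y, g y = 0 -> exists x, f x = y).
Proof.
move=> efg; split=> [x|y gy0].
  by have : (g @^-1` [set 0]) (f x) by rewrite -efg; exists x.
have : (g @^-1` [set 0]) y by [].
by rewrite -efg => -[x _ <-]; exists x.
Qed.

Lemma ses_intro {K L N} (f : {linear K -> L}) (g : {linear L -> N}) :
  injective f -> (forall x, g (f x) = 0) ->
  (forall y, g y = 0 -> exists x, f x = y) ->
  (forall z, exists y, g y = z) -> ses K L N.
Proof.
move=> f_inj gf0 ker_im g_surj; exists f, g; split=> //.
- apply/seteqP; split=> [_ [x _ <-]|y /ker_im[x <-]]; [exact: gf0|by exists x].
- by apply/seteqP; split=> // z _; have [y <-] := g_surj z; exists y.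
Qed.

Lemma linear_injP U V (f : {linear U -> V}) :
  (forall x, f x = 0 -> x = 0) -> injective f.
Proof.
move=> f0 x y fxy; apply/eqP; rewrite -subr_eq0; apply/eqP/f0.
by rewrite linearB fxy subrr.
Qed.

Lemma KerP {U V} (f : {linear U -> V}) (x : Ker f) : f (\val x) = 0.
Proof. exact: eqP (valP x). Qed.

Lemma to_Ker {U V W} (f : {linear U -> V}) (g : {linear V -> W}) :
  (forall x, g (f x) = 0) ->
  exists h : {linear U -> Ker g}, forall x, \val (h x) = f x.
Proof.
move=> gf0; have memf x : f x \in ker_pred g by apply/eqP.
have h_lin : linear (fun x => Submodule (memf x) : Ker g).
  by move=> a x y; apply: val_inj; rewrite /= linearP.
by have [h hE] := linear_pack _ _ _ h_lin; exists h => x; rewrite hE.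
Qed.

Lemma im_predP {U V} (f : {linear U -> V}) y :
  reflect (exists x, f x = y) (y \in im_pred f).
Proof.
by apply: (iffP (asboolP _)) => [[x _ <-]|[x <-]]; exists x.
Qed.

Lemma ImP {U V} (f : {linear U -> V}) (y : Im f) : exists x, f x = \val y.
Proof. exact/im_predP/(valP y). Qed.

Lemma to_Im {U V} (f : {linear U -> V}) :
  exists h : {linear U -> Im f}, forall x, \val (h x) = f x.
Proof.
have memf x : f x \in im_pred f by apply/im_predP; exists x.
have h_lin : linear (fun x => Submodule (memf x) : Im f).
  by move=> a x y; apply: val_inj; rewrite /= linearP.
by have [h hE] := linear_pack _ _ _ h_lin; exists h => x; rewrite hE.
Qed.

Lemma quotmod_lift {V W} (A : submodClosed V) (g : {linear V -> W}) :
  (forall x, x \in A -> g x = 0) ->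
  exists h : {linear quotmod A -> W}, forall x, h (quotmod_pi A x) = g x.
Proof.
move=> gA0.
pose h (u : quotmod A) := g (repr (u : Quotient.quot (quot_pred A))).
have hE x : h (quotmod_pi A x) = g x.
  apply/eqP; rewrite -subr_eq0 -linearB; apply/eqP/gA0/quotmod_piP.
  by rewrite {1}/quotmod_pi reprK.
have h_lin : linear h.
  move=> a u v; have [x ->] := quotmod_pi_surj u.
  by have [y ->] := quotmod_pi_surj v; rewrite -linearP !hE linearP.
by have [h' h'E] := linear_pack _ _ _ h_lin; exists h' => x; rewrite h'E.
Qed.

Lemma quotmod_pi0 {V} (A : submodClosed V) x :
  quotmod_pi A x = 0 <-> x \in A.
Proof. by rewrite -(linear0 (quotmod_pi A)) quotmod_piP subr0. Qed.

Lemma ses_Ker {U V} (f : {linear U -> V}) :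
  (forall y, exists x, f x = y) -> ses (Ker f) U V.
Proof.
apply: (ses_intro (\val : {linear Ker f -> U})) => [|x|x fx0].
- exact: val_inj.
- exact: KerP.
have memx : x \in ker_pred f by apply/eqP.
by exists (Submodule memx).
Qed.

Lemma ses_left_exact {U V W} (f : {linear U -> V}) (g : {linear V -> W}) :
  injective f -> (forall x, g (f x) = 0) ->
  (forall y, g y = 0 -> exists x, f x = y) -> ses U V (Im g).
Proof.
move=> f_inj gf0 ker_im; have [h hE] := to_Im g.
apply: (ses_intro f h) => // [x|y hy0|z].
- by apply: val_inj; rewrite hE gf0.
- by apply: ker_im; rewrite -hE hy0.
- by have [y yz] := ImP _ z; exists y; apply: val_inj; rewrite hE.
Qed.

Lemma ses_Ker_Im {U V} (f : {linear U -> V}) : ses (Ker f) U (Im f).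
Proof.
apply: (ses_left_exact (\val : {linear Ker f -> U}) f).
- exact: val_inj.
- exact: KerP.
- move=> x fx0; have memx : x \in ker_pred f by apply/eqP.
  by exists (Submodule memx).
Qed.

Lemma ses_Im_Im {U V W} (f : {linear U -> V}) (g : {linear V -> W}) :
  (forall x, g (f x) = 0) ->
  (forall y, g y = 0 -> exists x, f x = y) -> ses (Im f) V (Im g).
Proof.
move=> gf0 ker_im; apply: (ses_left_exact (\val : {linear Im f -> V}) g).
- exact: val_inj.
- by move=> y /=; have [x <-] := ImP _ y.
- move=> y /ker_im/im_predP memy; by exists (Submodule memy).
Qed.

Lemma ses_Coker {U V} (f : {linear U -> V}) : injective f -> ses U V (Coker f).
Proof.
move=> f_inj; apply: (ses_intro f (quotmod_pi (im_pred f))) => // [x|y|z].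
- by apply/quotmod_pi0/im_predP; exists x.
- by move/quotmod_pi0/im_predP.
- by have [y ->] := quotmod_pi_surj z; exists y.
Qed.

Lemma ses_Im_Coker {U V} (f : {linear U -> V}) : ses (Im f) V (Coker f).
Proof.
apply: (ses_intro (\val : {linear Im f -> V}) (quotmod_pi (im_pred f)))
  => [|y|y|z].
- exact: val_inj.
- exact/quotmod_pi0/(valP y).
- by move/quotmod_pi0 => memy; exists (Submodule memy).
- by have [y ->] := quotmod_pi_surj z; exists y.
Qed.

Lemma ses_homology {U V W} (f : {linear U -> V}) (g : {linear V -> W}) :
  (forall x, g (f x) = 0) -> ses (Im f) (Ker g) (homology f g).
Proof.
move=> gf0; have [|h hE] := to_Ker (\val : {linear Im f -> V}) g.
  by move=> y /=; have [x <-] := ImP _ y.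
apply: (ses_intro h (quotmod_pi (@boundary_pred _ _ _ _ f g)
    : {linear Ker g -> homology f g})) => [y1 y2 eqy|y|z|u].
- by apply: val_inj; rewrite -!hE eqy.
- by apply/quotmod_pi0; rewrite unfold_in hE; exact: valP.
- rewrite quotmod_pi0 unfold_in => memz.
  by exists (Submodule memz); apply: val_inj; rewrite hE.
- by have [z ->] := quotmod_pi_surj u; exists z.
Qed.

(** As [g] kills Im f, it descends to the cokernel of [f], and the descended map has kernel Ker g /
    Im f. *)
Lemma ses_homology_Coker {U V W} (f : {linear U -> V}) (g : {linear V -> W}) :
  (forall x, g (f x) = 0) -> ses (homology f g) (Coker f) (Im g).
Proof.
move=> gf0; pose p := quotmod_pi (im_pred f).
have [|i iE] := @quotmod_lift _ _ (@boundary_pred _ _ _ _ f g)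
    (p \o \val : {linear Ker g -> Coker f}).
  by move=> x; rewrite unfold_in => memx; apply/quotmod_pi0.
have [h hE] := to_Im g.
have [|q qE] := quotmod_lift (im_pred f) h.
  by move=> _ /im_predP[x <-]; apply: val_inj; rewrite hE gf0.
apply: (ses_intro i q) => [|u|v|z].
- apply: linear_injP => u; have [x ->] := quotmod_pi_surj u.
  by rewrite iE => /quotmod_pi0 memx; apply/quotmod_pi0.
- have [x ->] := quotmod_pi_surj u; rewrite iE qE.
  by apply: val_inj; rewrite hE KerP.
- have [y ->] := quotmod_pi_surj v; rewrite qE => hy0.
  have memy : y \in ker_pred g by apply/eqP; rewrite -hE hy0.
  by exists (quotmod_pi _ (Submodule memy)); rewrite iE.
- have [y yz] := ImP _ z; exists (quotmod_pi _ y).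
  by apply: val_inj; rewrite qE hE.
Qed.

Lemma Ker_eq0_inj {U V} (f : {linear U -> V}) :
  (forall x : Ker f, x = 0) -> injective f.
Proof.
move=> K0; apply: linear_injP => x fx0.
have memx : x \in ker_pred f by apply/eqP.
exact: (congr1 (fun y : Ker f => \val y) (K0 (Submodule memx))).
Qed.

Lemma Coker_eq0_surj {U V} (f : {linear U -> V}) :
  (forall x : Coker f, x = 0) -> forall y, exists x, f x = y.
Proof.
by move=> C0 y; have /quotmod_pi0/im_predP := C0 (quotmod_pi _ y).
Qed.

Lemma homology_eq0 {U V W} (f : {linear U -> V}) (g : {linear V -> W}) :
  (forall u : homology f g, u = 0) -> forall y, g y = 0 -> exists x, f x = y.
Proof.
move=> H0 y gy0; have memy : y \in ker_pred g by apply/eqP.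
have /quotmod_pi0 := H0 (quotmod_pi _ (Submodule memy)).
by rewrite unfold_in => /im_predP.
Qed.

(** Invariance of depth under isomorphism is derived from retracts, hence the explicit two-sided
    inverse. *)
Lemma ses_linv {K L N} : ses K L N -> (forall x : K, x = 0) ->
  exists (f : {linear L -> N}) (h : {linear N -> L}), cancel f h /\ cancel h f.
Proof.
move=> [i [f [_ ei ef]]] K0.
have f0 x : f x = 0 -> x = 0.
  move=> fx0; have : (f @^-1` [set 0]) x by [].
  by rewrite -ei => -[k _ <-]; rewrite (K0 k) linear0.
have f_inj := linear_injP _ _ _ f0.
have /choice[h fh] : forall z, exists y, f y = z.
  by move=> z; have : [set: N] z by []; rewrite -ef => -[y _ <-]; exists y.
have h_lin : linear h.
  by move=> a x y; apply: f_inj; rewrite linearP !fh.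
have [h' h'E] := linear_pack _ _ _ h_lin.
exists f, h'; split=> x; last by rewrite h'E fh.
by apply: f_inj; rewrite h'E fh.
Qed.

(** Both orders of the splitting of Y into X and Ker b, with y - a (b y) as projection onto Ker b;
    comparing them bounds the depth of a retract. *)
Lemma ses_retract {X Y} (a : {linear X -> Y}) (b : {linear Y -> X}) :
  cancel a b -> ses (Ker b) Y X /\ ses X Y (Ker b).
Proof.
move=> ab; split; first by apply: ses_Ker => x; exists (a x).
have c_lin : linear (fun y => y - a (b y)).
  by move=> k x y; rewrite (linearP b) (linearP a) scalerBr opprD addrACA.
have [c cE] := linear_pack _ _ _ c_lin.
have [|h hE] := to_Ker c b; first by move=> y; rewrite cE linearB ab subrr.
apply: (ses_intro a h) => [|x|y hy0|z].
- exact: can_inj ab.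
- by apply: val_inj; rewrite hE cE ab subrr.
- by exists (b y); apply/eqP; rewrite eq_sym -subr_eq0 -cE -hE hy0.
- by exists (\val z); apply: val_inj; rewrite hE cE KerP linear0 subr0.
Qed.

Lemma ses_ffun V n :
  ses V {ffun 'I_n.+1 -> V} {ffun 'I_n -> V}.
Proof.
have i_lin : linear (fun x : V =>
    [ffun i : 'I_n.+1 => if i == ord0 then x else 0]).
  move=> a x y; apply/ffunP => j; rewrite !ffunE.
  by case: eqP => _ //; rewrite scaler0 addr0.
have p_lin : linear (fun v : {ffun 'I_n.+1 -> V} =>
    [ffun j : 'I_n => v (lift ord0 j)]).
  by move=> a x y; apply/ffunP => j; rewrite !ffunE.
have [i iE] := linear_pack _ _ _ i_lin; have [p pE] := linear_pack _ _ _ p_lin.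
apply: (ses_intro i p) => [x y|x|v pv0|w].
- by rewrite !iE => /ffunP/(_ ord0); rewrite !ffunE.
- by rewrite pE iE; apply/ffunP => j; rewrite !ffunE.
- exists (v ord0); rewrite iE; apply/ffunP => j; rewrite !ffunE.
  case: (unliftP ord0 j) => [k ->|->] //.
  by have /ffunP/(_ k) := pv0; rewrite pE !ffunE.
- exists [ffun j => if unlift ord0 j is Some k then w k else 0].
  by rewrite pE; apply/ffunP => j; rewrite !ffunE liftK.
Qed.
End ExactSequences.

(** * Duals of projective resolutions *)

Section DualSequences.
Context {Lambda Gamma : pzRingType} (C : bimodType Lambda Gamma).
Implicit Types X Y M : lmodType Gamma^c.

Lemma dual_linear {X} (u : dual C X) : linear (\val u : X -> right_module C).
Proof. exact/asboolP/(valP u). Qed.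

Lemma dualP {X} (u v : dual C X) : (forall x, \val u x = \val v x) -> u = v.
Proof. by move=> uv; apply/val_inj/funext. Qed.

Lemma to_dual {X} (f : X -> C) :
  linear (f : X -> right_module C) -> exists u : dual C X, \val u = f.
Proof.
move=> f_lin; have memf : f \in @dual_pred _ _ C X by apply/asboolP.
by exists (Submodule memf).
Qed.

Lemma dual0E {X} (x : X) : \val (0 : dual C X) x = 0.
Proof. by []. Qed.

Lemma dual_map_comp0 {X Y M} (f : {linear X -> Y}) (g : {linear Y -> M}) u :
  (forall x, g (f x) = 0) -> dual_map C f (dual_map C g u) = 0.
Proof.
move=> gf0; apply: dualP => x; rewrite dual0E /= gf0.
have [h hE] := linear_pack _ _ _ (dual_linear u).
by rewrite -hE linear0.
Qed.

(** A homomorphism killing the image of [f] is constant on the fibres of [g], so its composite with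
    a set-theoretic section of [g] is linear. *)
Lemma dual_left_exact {X Y M} (f : {linear X -> Y}) (g : {linear Y -> M}) :
  range g = setT -> range f = g @^-1` [set 0] ->
  injective (dual_map C g) /\
  (forall v, dual_map C f v = 0 -> exists u, dual_map C g u = v).
Proof.
move=> g_surj /range0P[gf0 ker_im].
have /choice[s sK] : forall z, exists y, g y = z.
  by move=> z; have : [set: M] z by []; rewrite -g_surj => -[y _ <-]; exists y.
split=> [u1 u2 equ|v fv0].
  apply: dualP => z; rewrite -(sK z).
  by have := congr1 (fun w => \val w (s z)) equ.
have [h hE] := linear_pack _ _ _ (dual_linear v).
have vg y1 y2 : g y1 = g y2 -> h y1 = h y2.
  move=> gy; have [|x fx] := ker_im (y1 - y2).
    by rewrite linearB gy subrr.
  apply/eqP; rewrite -subr_eq0 -linearB -fx hE; apply/eqP.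
  exact: (congr1 (fun w : dual C X => \val w x) fv0).
have [|u uE] := to_dual (h \o s).
  by move=> a x y; rewrite /= -linearP; apply: vg; rewrite linearP !sK.
exists u; apply: dualP => y; rewrite /= uE /= -hE.
by apply: vg; rewrite sK.
Qed.

(** The surjection Gamma^n -> X given by generators splits by projectivity, and the dual of Gamma^n
    is C^n. *)
Lemma dual_fgproj_retract {X} : finitely_generated X -> projective X ->
  exists n (a : {linear dual C X -> {ffun 'I_n -> C}})
    (b : {linear {ffun 'I_n -> C} -> dual C X}), cancel a b.
Proof.
move=> [n [v v_gen]] X_proj; exists n.
have g_lin : linear (fun c : {ffun 'I_n -> Gamma^c^o} =>
    \sum_i (c i : Gamma^c) *: v i).
  move=> k x y; rewrite scaler_sumr -big_split; apply: eq_bigr => i _.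
  by rewrite !ffunE scalerDl scalerA.
have [g gE] := linear_pack _ _ _ g_lin.
have [|h hK] := X_proj _ _ g (idfun : {linear X -> X}).
  apply/seteqP; split=> // x _; have [c ->] := v_gen x.
  exists [ffun i => c i] => //.
  by rewrite gE; apply: eq_bigr => i _; rewrite ffunE.
have a_lin : linear (fun u : dual C X => [ffun i => \val u (v i)]).
  by move=> k x y; apply/ffunP => i; rewrite !ffunE.
have [a aE] := linear_pack _ _ _ a_lin.
(* The coordinates [h x i] act as a dual basis: w goes to the functional x |-> sum_i w_i h_i(x). *)
have b_lin (w : {ffun 'I_n -> C}) :
    linear (fun x => \sum_i (h x i : Gamma^c) *: (w i : right_module C)).
  move=> k x y; rewrite linearP scaler_sumr -big_split; apply: eq_bigr => i _.
  by rewrite !ffunE scalerDl scalerA.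
have /choice[b0 b0E] := fun w => to_dual _ (b_lin w).
have b0_lin : linear b0.
  move=> k w1 w2; apply: dualP => x.
  change (\val (b0 (k *: w1 + w2)) x = k *: (\val (b0 w1) x) + \val (b0 w2) x).
  rewrite !b0E scaler_sumr -big_split; apply: eq_bigr => i _.
  by rewrite !ffunE [LHS]rscaleDl -scaler_rscale.
have [b bE] := linear_pack _ _ _ b0_lin.
exists a, b => u; apply: dualP => x; rewrite bE b0E aE.
have [u' u'E] := linear_pack _ _ _ (dual_linear u).
have /= hx := hK x; rewrite -u'E -[x in RHS]hx gE linear_sum.
apply: eq_bigr => i _.
by rewrite linearZ u'E ffunE.
Qed.
End DualSequences.

(** * Depth functions *)

Lemma nneg_int_ereal_cases (x : \bar int) :
  (0 <= x)%E -> x = +oo%E \/ exists n : nat, x = (n%:Z)%:E.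
Proof.
by move=> /gee0P[->|[[n|n] //= _ ->]]; [left|right; exists n].
Qed.

(** Once every depth is +oo or a natural number, these rules leave only integer comparisons for
    [lia]. *)
Lemma int_erealE :
  (forall m n : int, ((m%:E = n%:E) = (m = n)) *
    ((m%:E <= n%:E)%E = (m <= n)) * ((m%:E < n%:E)%E = (m < n))) *
  (forall n : int, ((n%:E = +oo%E) = False) * ((+oo%E = n%:E) = False) *
    ((n%:E <= +oo)%E = true) * ((n%:E < +oo)%E = true) *
    ((+oo <= n%:E)%E = false) * ((+oo < n%:E)%E = false) *
    ((n%:E + 1)%E = (n + 1)%:E)) * ((+oo + 1)%E = (+oo%E : \bar int)) *
  (((+oo%E : \bar int) = +oo%E) = True).
Proof.
do !split=> //=; rewrite ?lee_fin ?lte_fin ?leey ?ltry //.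
- by rewrite propeqE; split=> [[]|->].
all: by rewrite propeqE; split.
Qed.

Ltac int_ereal :=
  rewrite ?ge_min ?int_erealE ?lexx ?ltxx /=; lia.

Section Depth.
Context {R : pzRingType} (d : lmodType R -> \bar int).
Hypotheses (d_ge0 : nneg_valued d) (d1 : cond_d1 d) (d2 : cond_d2 d)
  (d3 : cond_d3 d).
Implicit Types E K L N V X Y : lmodType R.

Lemma depth_ses_cases {K L N} : ses K L N ->
  [/\ (d K < d L)%E -> d K = (d N + 1)%E, (d N < d L)%E -> d K = (d N + 1)%E
    & (d L < d N)%E -> (d K <= d L)%E].
Proof.
by move=> [f [g fg]]; split; [exact: d1 fg|exact: d2 fg|exact: d3 fg].
Qed.

(** If d(X) < d(Y), the two split sequences give d(Ker b) = d(X) + 1 by (d2) and d(X) = d(Ker b) + 1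
    by (d1), impossible as d(X) is finite. *)
Lemma depth_retract {X Y} (a : {linear X -> Y})
    (b : {linear Y -> X}) : cancel a b -> (d Y <= d X)%E.
Proof.
move=> /ses_retract[/depth_ses_cases[_ + _] /depth_ses_cases[+ _ _]].
have [->|[x ->]] := nneg_int_ereal_cases _ (d_ge0 X);
have [->|[y ->]] := nneg_int_ereal_cases _ (d_ge0 Y);
have [->|[z ->]] := nneg_int_ereal_cases _ (d_ge0 (Ker b)); int_ereal.
Qed.

Lemma depth_linv {K L N} : ses K L N -> (forall x : K, x = 0) -> d L = d N.
Proof.
move=> KLN /(ses_linv KLN)[f [h [fK hK]]].
by apply/le_anti; rewrite (depth_retract _ _ hK) (depth_retract _ _ fK).
Qed.

(** In V -> V^(n+1) -> V^n, a middle depth below d(V) would also be below d(V^n), against (d3). *)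
Lemma depth_ffun V n : (d V <= d {ffun 'I_n -> V})%E.
Proof.
elim: n => [|n IHn].
  apply: (@depth_retract _ _ (\0 : {linear {ffun 'I_0 -> V} -> V})
    (\0 : {linear V -> {ffun 'I_0 -> V}})) => x.
  by apply/ffunP; case.
have [+ + +] := depth_ses_cases (ses_ffun V n); move: IHn.
have [->|[x ->]] := nneg_int_ereal_cases _ (d_ge0 V);
have [->|[y ->]] := nneg_int_ereal_cases _ (d_ge0 {ffun 'I_n -> V});
have [->|[z ->]] := nneg_int_ereal_cases _ (d_ge0 {ffun 'I_n.+1 -> V});
int_ereal.
Qed.

(** * Depth bounds relative to C and detection *)

Section Detects.
Variable C : lmodType R.

(* The second clause makes k a lower bound of N relative to C (the supremum
   defining Stilde is at least k), and the first then decides whether k is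
   exceeded in terms of the depth of E. *)
Definition detects E N (k : int) : Prop :=
  ((k + 1)%:E <= d C -> (d E = 0%:E <-> d N = k%:E))%E /\
  (Order.min k%:E (d C) <= d N)%E.

(** If k + 1 < d(C), then L is deeper than a K of depth k + 1 and than an N of depth k, so (d1) and
    (d2) turn each equality into the other. For the lower bound, either d(K) >= d(L) or d(K) = d(N)
    + 1. *)
Lemma detects_step {E K L N} (k : nat) : ses K L N ->
  (Order.min (k%:Z + 2)%:E (d C) <= d L)%E ->
  detects E N k%:Z -> detects E K (k%:Z + 1).
Proof.
rewrite /detects => /depth_ses_cases[+ + _].
have [->|[c ->]] := nneg_int_ereal_cases _ (d_ge0 C);
have [->|[x ->]] := nneg_int_ereal_cases _ (d_ge0 K);
have [->|[y ->]] := nneg_int_ereal_cases _ (d_ge0 L);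
have [->|[e ->]] := nneg_int_ereal_cases _ (d_ge0 E);
have [->|[z ->]] := nneg_int_ereal_cases _ (d_ge0 N); int_ereal.
Qed.

(** If d(C) >= 1, then d(N) >= 1, so (d1) excludes d(E) = 0 < d(L), and (d3) gives d(E) = 0 from
    d(L) = 0. *)
Lemma detects_base {E L N} : ses E L N ->
  (Order.min 1%:E (d C) <= d N)%E -> detects E L 0.
Proof.
rewrite /detects => /depth_ses_cases[+ _ +].
have [->|[c ->]] := nneg_int_ereal_cases _ (d_ge0 C);
have [->|[x ->]] := nneg_int_ereal_cases _ (d_ge0 E);
have [->|[y ->]] := nneg_int_ereal_cases _ (d_ge0 L);
have [->|[z ->]] := nneg_int_ereal_cases _ (d_ge0 N); int_ereal.
Qed.

Lemma min_depth_sub {K L N} (k : nat) : ses K L N ->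
  (Order.min (k%:Z + 1)%:E (d C) <= d L)%E ->
  (Order.min k%:Z%:E (d C) <= d N)%E ->
  (Order.min (k%:Z + 1)%:E (d C) <= d K)%E.
Proof.
move=> /depth_ses_cases[+ _ _].
have [->|[c ->]] := nneg_int_ereal_cases _ (d_ge0 C);
have [->|[x ->]] := nneg_int_ereal_cases _ (d_ge0 K);
have [->|[y ->]] := nneg_int_ereal_cases _ (d_ge0 L);
have [->|[z ->]] := nneg_int_ereal_cases _ (d_ge0 N); int_ereal.
Qed.

Lemma detects0 E : detects E E 0.
Proof. by split=> //; rewrite ge_min d_ge0. Qed.

End Detects.
End Depth.

(** * The dual complex *)

Section Chain.
Context {Lambda Gamma : pzRingType} (C : bimodType Lambda Gamma).
Context {M : lmodType Gamma^c} (P : fgproj_resolution M).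
Context {W : lmodType Lambda} (lambda : {linear W -> dual C M}).
Context (d : lmodType Lambda -> \bar int).
Hypotheses (d_ge0 : nneg_valued d) (d1 : cond_d1 d) (d2 : cond_d2 d)
  (d3 : cond_d3 d).
Local Notation detects := (detects d C).
Local Notation delta n := (codiff C P n).
Local Notation "k <=C N" := (Order.min k%:E (d C) <= d N)%E (at level 70).

Lemma codiffK n x : delta n.+1 (delta n x) = 0.
Proof. by apply: dual_map_comp0; exact: (range0P _ _ (res_exact P n)).1. Qed.

Lemma min_depth_dual_res n (k : int) : k <=C dual C (P n).
Proof.
have [m [a [b ab]]] := dual_fgproj_retract C (res_fg P n) (@res_proj _ _ P n).
rewrite ge_min (le_trans (depth_ffun d d_ge0 d1 d2 d3 C m)) ?orbT //.
exact: depth_retract ab.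
Qed.

Lemma min_depth_Im {U V : lmodType Lambda} (f : {linear U -> V}) :
  1 <=C V -> 1 <=C Im f.
Proof.
move=> V1; apply: (min_depth_sub _ d_ge0 d1 d2 d3 _ 0 (ses_Im_Coker f)) => //.
by rewrite ge_min d_ge0.
Qed.

(** Composing with an isomorphism [f] lets one sequence serve both M^dagger and, once [lambda] is
    bijective, W. *)
Lemma ses_dual_res {U : lmodType Lambda} (f : {linear U -> dual C M}) :
  injective f -> (forall v, exists u, f u = v) ->
  ses U (dual C (P 0%N)) (Im (delta 0)).
Proof.
move=> f_inj f_surj.
have [aug_inj aug_ker] := dual_left_exact C _ _ (res_aug_surj P) (res_exact0 P).
apply: (ses_left_exact (dual_map C (res_aug P) \o f) (delta 0)) => [x y|x|v].
- by move=> /aug_inj/f_inj.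
- by apply: dual_map_comp0; exact: (range0P _ _ (res_exact0 P)).1.
- by move=> /aug_ker[w <-]; have [u <-] := f_surj w; exists u.
Qed.

Lemma min_depth_Ker_codiff n : 2 <=C Ker (delta n).
Proof.
apply: (min_depth_sub _ d_ge0 d1 d2 d3 _ 1 (ses_Ker_Im (delta n))).
  exact: min_depth_dual_res.
exact/min_depth_Im/min_depth_dual_res.
Qed.

Lemma min_depth_dual : 2 <=C dual C M.
Proof.
have := ses_dual_res (idfun : {linear dual C M -> dual C M}).
move=> /(_ (@inj_id _))[|f [g fg]]; first by move=> v; exists v.
have MP : ses (dual C M) (dual C (P 0%N)) (Im (delta 0)) by exists f, g.
apply: (min_depth_sub _ d_ge0 d1 d2 d3 _ 1 MP).
  exact: min_depth_dual_res.
exact/min_depth_Im/min_depth_dual_res.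
Qed.

Section Vanishing.
Context (t : nat).
Hypothesis E_eq0 : forall i, (i < t)%N -> forall x : E_ P lambda i.+1, x = 0.

(** [Im (delta j)] is B^(j+1). The induction runs on the distance m from j to s: each step to the
    left in the complex raises the level by one. *)
Lemma detects_Im_codiff s m j : (s.+2 <= t)%N -> (j + m)%N = s ->
  detects (Ext C P s.+1) (Im (delta j)) (m%:Z + 1).
Proof.
move=> st; elim: m j => [|m IHm] j js.
  move: js; rewrite addn0 => ->.
  (* B^(s+1) lies in the cocycles with quotient Ext^(s+1), which detects itself at level 0. *)
  apply: (detects_step _ d_ge0 d1 d2 d3 _ 0 (ses_homology _ _ (codiffK s))).
    exact: min_depth_Ker_codiff.
  exact: detects0.
have js' : (j.+1 + m)%N = s by lia.
(* [E_] at index j + 3 is Ext^(j+1), whose vanishing gives exactness at P_(j+1)^dagger. *)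
have jt : (j.+2 < t)%N by lia.
have ses_j : ses (Im (delta j)) (dual C (P j.+1)) (Im (delta j.+1)).
  by exact: (ses_Im_Im _ _ (codiffK j) (homology_eq0 _ _ (E_eq0 _ jt))).
apply: (detects_step _ d_ge0 d1 d2 d3 _ m.+1 ses_j (min_depth_dual_res _ _)).
by rewrite intS addrC; exact: IHm.
Qed.

Lemma detects_W : detects (E_ P lambda t.+1) W t%:Z.
Proof.
case: t E_eq0 detects_Im_codiff => [|[|s]] E0 detects_Im.
- apply: (detects_base _ d_ge0 d1 d2 d3 _ (ses_Ker_Im lambda)).
  apply: min_depth_Im; apply: le_trans min_depth_dual.
  by rewrite le_min !ge_min lexx !orbT lee_fin.
- have lambda_inj := Ker_eq0_inj lambda (E0 0%N isT).
  apply: (detects_step _ d_ge0 d1 d2 d3 _ 0 (ses_Coker lambda lambda_inj)).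
    exact: min_depth_dual.
  exact: detects0.
- have lambda_inj := Ker_eq0_inj lambda (E0 0%N isT).
  have lambda_surj := Coker_eq0_surj lambda (E0 1%N isT).
  have W_Im := ses_dual_res lambda lambda_inj lambda_surj.
  have -> : s.+2%:Z = s.+1%:Z + 1 by lia.
  apply: (detects_step _ d_ge0 d1 d2 d3 _ s.+1 W_Im).
    exact: min_depth_dual_res.
  by rewrite intS addrC; exact: detects_Im.
Qed.

Lemma detects_O i : (2 <= t)%N -> (i <= 2)%N ->
  detects (E_ P lambda t.+1) (O_ P lambda i) (t%:Z + i%:Z - 2).
Proof.
move=> t2; case: i => [|[|[|//]]] _; last by rewrite addrK; exact: detects_W.
- case: t t2 E_eq0 detects_Im_codiff => [|[|s]] // _ E0 detects_Im.
  have -> : s.+2%:Z + 0%:Z - 2 = s%:Z by lia.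
  have E_Coker := ses_homology_Coker _ _ (codiffK 0).
  case: s E0 detects_Im => [|s] E0 detects_Im.
    (* Here t = 2, so the kernel Ext^1 of the map from the cokernel onto B^2 is E^(t+1) itself. *)
    apply: (detects_base _ d_ge0 d1 d2 d3 _ E_Coker).
    exact/min_depth_Im/min_depth_dual_res.
  (* Here t > 2, so Ext^1 = E^3 vanishes and the cokernel has the depth of B^2. *)
  rewrite intS addrC /detects.
  rewrite /O_ (depth_linv _ d_ge0 d1 d2 d3 E_Coker (E0 2%N isT)).
  exact: (detects_Im s.+1 s 1%N).
- case: t t2 detects_Im_codiff => [|[|s]] // _ detects_Im.
  have -> : s.+2%:Z + 1%:Z - 2 = s%:Z + 1 by lia.
  exact: detects_Im.
Qed.
End Vanishing.
End Chain.

(** * Loci of points and the relative supremum *)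

Section LociOfDetection.
Context {Lambda : pzRingType} {S : Type} (d : S -> lmodType Lambda -> \bar int).
Hypothesis d_ge0 : forall p, nneg_valued (d p).
Context (C E N : lmodType Lambda) (k : int).
Hypothesis detectsE : forall p, detects (d p) C E N k.

(** Both sides force d_p(C) >= k + 1, on the right because depths are integers or +oo; [detects]
    then exchanges d_p(E) = 0 with d_p(N) = k. *)
Lemma detects_locus : A_ d 0 E `&` X_ d (k + 1) C = A_ d k N `&` Y_ d C N.
Proof.
apply/seteqP; split=> p; rewrite /A_ /X_ /Y_ /=; have := (detectsE p).1.
- move=> + [dE dC] => /(_ dC)[/(_ dE) -> _]; split=> //.
  apply: lt_le_trans dC; rewrite lte_fin; lia.
- move=> + [dN]; rewrite dN => + dC.
  have {}dC : ((k + 1)%:E <= d p C)%E.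
    move: dC; have [->|[c ->]] := nneg_int_ereal_cases _ (d_ge0 p C); int_ereal.
  by move=> /(_ dC)[_ ->].
Qed.

(** The supremum is at least k. It equals k exactly when k + 1 fails at some p, which together with
    min(k, d_p(C)) <= d_p(N) means d_p(N) = k < d_p(C). *)
Lemma detects_Stilde :
  A_ d 0 E `&` X_ d (k + 1) C !=set0 <-> k%:E = Stilde d C N.
Proof.
rewrite detects_locus /Stilde.
set B := [set i : int | _]; set B' := [set _ | _ in _].
have Bk : B k by move=> p; exact: (detectsE p).2.
have B'k : B' k%:E by exists k.
have B'0 : (B' == set0) = false by apply/negP => /eqP B0; rewrite B0 in B'k.
split=> [[p [dN dNC]]|kE].
- have B_le i : B i -> i <= k.
    move=> /(_ p); rewrite ge_min dN lee_fin => /orP[//|].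
    move: dNC; by rewrite /Y_ /= dN ltNge => /negP + ?.
  have supk : supremums B' k%:E.
    split=> [_ [i /B_le ik <-]|y /(_ _ B'k)//]; by rewrite lee_fin.
  rewrite /supremum B'0; case: xgetP => [y -> supy|/(_ k%:E)//].
  exact: is_subset1_supremums supk supy.
- have [k1|] := pselect (B (k + 1)).
    (* If [B'] had no supremum, [supremum] would return its default -oo, which is not the integer
       k. *)
    have supB : supremums B' !=set0.
      apply/set0P/negP => /eqP B0; move: kE; rewrite /supremum B'0 B0.
      by case: xgetP => // y _ [].
    have : B' (k + 1)%:E by exists (k + 1).
    move=> /(ge_supremum_Nmem -oo%E supB); rewrite -kE lee_fin; lia.
  move=> /existsNP[p]; have := Bk p; move=> + kp => dk; exists p.
  rewrite /A_ /Y_ /=; move: dk kp.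
  have [->|[c ->]] := nneg_int_ereal_cases _ (d_ge0 p C);
  have [->|[x ->]] := nneg_int_ereal_cases _ (d_ge0 p N); int_ereal.
Qed.
End LociOfDetection.

(** * Vanishing below t and assembly *)

Lemma t_vanishing {Lambda Gamma : pzRingType} (C : bimodType Lambda Gamma)
  (M : lmodType Gamma^c) (P : fgproj_resolution M)
  (W : lmodType Lambda) (lambda : {linear W -> dual C M}) (t : nat) :
  t_ P lambda = (t%:Z)%:E ->
  forall i, (i < t)%N -> forall x : E_ P lambda i.+1, x = 0.
Proof.
rewrite /t_; set A := [set i : nat | _]; set A' := image _ _ => tE i it x.
apply/eqP/negPn/negP => /eqP x0.
have Ai : A i by exists x.
have A'i : A' (i%:Z)%:E by exists i.
(* [infimum] is known to be a lower bound once an infimum exists; the least index in [A] provides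
   one. *)
have infA : infimums A' !=set0.
  have [|m /asboolP Am m_min] := ex_minnP (P := fun j => `[< A j >]).
    by exists i; apply/asboolP.
  exists (m%:Z)%:E; split=> [_ [j Aj <-]|y /(_ (m%:Z)%:E)].
    2: by apply; exists m.
  by rewrite lee_fin lez_nat m_min //; apply/asboolP.
have := le_infimum_Nmem +oo%E infA A'i; rewrite tE lee_fin; lia.
Qed.

Theorem theorem3p1
  (Lambda Gamma : pzRingType) (C : bimodType Lambda Gamma)
  (M : lmodType Gamma^c) (P : fgproj_resolution M)
  (W : lmodType Lambda) (lambda : {linear W -> dual C M})
  (S : Type) (S_nonempty : [set: S] !=set0)
  (d : S -> lmodType Lambda -> \bar int)
  (d_ge0 : forall p, nneg_valued (d p))
  (d_d1 : forall p, cond_d1 (d p))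
  (d_d2 : forall p, cond_d2 (d p))
  (d_d3 : forall p, cond_d3 (d p))
  (t : nat) (tE : t_ P lambda = (t%:Z)%:E) :
  (* (A) *)
  [/\ A_ d 0 (E_ P lambda t.+1) `&` X_ d (t%:Z + 1) C
        = A_ d t%:Z W `&` Y_ d C W
    & (2 <= t)%N -> forall i : nat, (i <= 2)%N ->
      A_ d 0 (E_ P lambda t.+1) `&` X_ d (t%:Z + i%:Z - 1) C
        = A_ d (t%:Z + i%:Z - 2) (O_ P lambda i) `&` Y_ d C (O_ P lambda i)]
  /\
  (* (B) *)
  [/\ A_ d 0 (E_ P lambda t.+1) `&` X_ d (t%:Z + 1) C !=set0
        <-> (t%:Z)%:E = Stilde d C W
    & (2 <= t)%N -> forall i : nat, (i <= 2)%N ->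
      (A_ d 0 (E_ P lambda t.+1) `&` X_ d (t%:Z + i%:Z - 1) C !=set0
        <-> (t%:Z + i%:Z - 2)%:E = Stilde d C (O_ P lambda i))].
Proof.
have E_eq0 := t_vanishing _ _ _ _ _ _ tE.
have dW p := detects_W C P lambda (d p) (d_ge0 p) (d_d1 p) (d_d2 p) (d_d3 p)
  t E_eq0.
have dO i p := detects_O C P lambda (d p) (d_ge0 p) (d_d1 p) (d_d2 p) (d_d3 p)
  t E_eq0 i.
(* The level of O^i is k = t + i - 2, and [X_] enters at k + 1. *)
have shift (i : nat) : t%:Z + i%:Z - 1 = t%:Z + i%:Z - 2 + 1 by lia.
split; split.
- exact: detects_locus.
- move=> t2 i i2; rewrite shift; apply: detects_locus => // p; exact: dO.
- exact: detects_Stilde.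
- move=> t2 i i2; rewrite shift; apply: detects_Stilde => // p; exact: dO.
Qed.
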